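(* Let $n$ be a positive integer, let $q\ge 2$ be an integer, and let $h:[-1,1)\to(0,+\infty)$ be absolutely monotone on $[-1,1)$. Let $k$ be a positive integer and $M$ an integer. Then $$\mathcal{E}(n,M;h)\ \ge\ \begin{cases} M\sum_{i=0}^{k-1}\rho_i h(\alpha_i), & \text{if } M\in(R(n,2k-1),R(n,2k)],\\[4pt] M\sum_{i=0}^{k}\gamma_i h(\beta_i), & \text{if } M\in(R(n,2k),R(n,2k+1)].\end{cases}$$ Moreover, these bounds cannot be improved by utilizing polynomials of degree at most $\tau$ lying below $h$, where $\tau=2k-1$ in the first case and $\tau=2k$ in the second case; that is, for every real polynomial $f$ of degree at most $\tau$ satisfying $f(t)\le h(t)$ for every $t\in[-1,1)$, the quantity $f_0M-f(1)$ does not exceed the corresponding right-hand side.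
   Context: $\mathbb{H}(n,q)$ is the set of all vectors of length $n$ over $\{0,1,\dots,q-1\}$, $d(x,y)$ is the Hamming distance, and $\langle x,y\rangle:=1-\frac{2d(x,y)}{n}$. A code is a nonempty subset $C\subset\mathbb{H}(n,q)$; its $h$-energy is $E(n,C;h):=\frac{1}{|C|}\sum_{x,y\in C,\,x\ne y}h(\langle x,y\rangle)$, and $\mathcal{E}(n,M;h):=\min\{E(n,C;h): C\subset\mathbb{H}(n,q),\ |C|=M\}$. A function $h$ is absolutely monotone on $[-1,1)$ if $h$ and all its derivatives are defined and nonnegative on $[-1,1)$. Rao bound: $R(n,2k-1):=q\sum_{i=0}^{k-1}\binom{n-1}{i}(q-1)^i$ and $R(n,2k):=\sum_{i=0}^{k}\binom{n}{i}(q-1)^i$. For a real polynomial $f$, $f_0:=q^{-n}\sum_{z=0}^{n}\binom{n}{z}(q-1)^z f\left(1-\frac{2z}{n}\right)$; for $\deg f\le n$ this is the coefficient $f_0$ in the Krawtchouk expansion $f=\sum_{i=0}^n f_iQ_i^{(n,q)}$, where $Q_i^{(n,q)}(t)=K_i^{(n,q)}(z)/\left((q-1)^i\binom{n}{i}\right)$, $z=n(1-t)/2$, $K_i^{(n,q)}(z)=\sum_{j=0}^i(-1)^j(q-1)^{i-j}\binom{z}{j}\binom{n-z}{i-j}$. Nodes and weights (Levenshtein). For $M\in(R(n,2k-1),R(n,2k)]$, the reals $-1<\alpha_0<\alpha_1<\dots<\alpha_{k-1}<1$ and positive numbers $\rho_0,\dots,\rho_{k-1}$ are the uniquely determined numbers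 such that $f_0=\frac{f(1)}{M}+\sum_{i=0}^{k-1}\rho_if(\alpha_i)$ for every real polynomial $f$ of degree at most $2k-1$. For $M\in(R(n,2k),R(n,2k+1)]$, the reals $-1=\beta_0<\beta_1<\dots<\beta_k<1$ and positive numbers $\gamma_0,\dots,\gamma_k$ are the uniquely determined numbers such that $f_0=\frac{f(1)}{M}+\sum_{i=0}^{k}\gamma_if(\beta_i)$ for every real polynomial $f$ of degree at most $2k$. *)

(* Defs.v *)
(* MathComp / MathComp-Analysis *)
From HB Require Import structures.
From mathcomp Require Import all_boot all_order all_algebra.
From mathcomp Require Import all_classical all_reals all_analysis.

Set Implicit Arguments.
Unset Strict Implicit.
Unset Printing Implicit Defensive.

Import Order.TTheory GRing.Theory Num.Theory.
Import numFieldNormedType.Exports.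

Local Open Scope classical_set_scope.
Local Open Scope ring_scope.

Notation hamming_space n q := {ffun 'I_n -> 'I_q}.

Definition hamming_dist (n q : nat) (x y : hamming_space n q) : nat :=
  #|[set i | x i != y i]%SET|.

Definition hamming_inner (R : realType) (n q : nat) (x y : hamming_space n q) : R :=
  1 - 2 * (hamming_dist x y)%:R / n%:R.

Definition energy (R : realType) (n q : nat) (h : R -> R)
    (C : {set hamming_space n q}) : R :=
  #|C|%:R^-1 *
  \sum_(x in C) \sum_(y in C | x != y) h (hamming_inner R x y).

(* The neutral element +oo is the value only when there is no code of size M,
   that is, when M > q ^ n. *)
Definition min_energy (R : realType) (n q M : nat) (h : R -> R) : \bar R :=
  \big[Order.min/+oo%E]_(C : {set hamming_space n q} | #|C| == M)
    (energy h C)%:E.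

(* Derivatives relative to a domain D: the difference quotient at t is taken
   along points of D only, so that values of f outside D are irrelevant and the
   derivative is one-sided at an endpoint belonging to D. *)
Definition slope_at (R : realType) (f : R -> R) (t s : R) : R :=
  (f s - f t) / (s - t).

Definition derivable_in (R : realType) (D : set R) (f : R -> R) (t : R) : Prop :=
  cvg (slope_at f t s @[s --> within D t^']).

Definition derive_in (R : realType) (D : set R) (f : R -> R) (t : R) : R :=
  lim (slope_at f t s @[s --> within D t^']).

Definition derive_in_n (R : realType) (D : set R) (j : nat) (f : R -> R) : R -> R :=
  iter j (derive_in D) f.

Definition absolutely_monotone (R : realType) (D : set R) (h : R -> R) : Prop :=
  forall (j : nat) (t : R), D t ->
    derivable_in D (derive_in_n D j h) t /\ 0 <= derive_in_n D j h t.

(* With m = 2k-1 one has uphalf m = k, and with m = 2k one has m./2 = k. *)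
Definition rao (n q m : nat) : nat :=
  if odd m then (q * \sum_(i < uphalf m) 'C(n.-1, i) * q.-1 ^ i)%N
  else (\sum_(i < (m./2).+1) 'C(n, i) * q.-1 ^ i)%N.

Definition zeroth_coef (R : realType) (n q : nat) (f : {poly R}) : R :=
  (q ^ n)%:R^-1 *
  \sum_(z < n.+1) ('C(n, z) * q.-1 ^ z)%:R * f.[1 - 2 * z%:R / n%:R].

Definition quadrature (R : realType) (n q M tau m : nat)
    (x w : 'I_m -> R) : Prop :=
  forall f : {poly R}, (size f <= tau.+1)%N ->
    zeroth_coef n q f = f.[1] / M%:R + \sum_(i < m) w i * f.[x i].

Definition levenshtein_odd (R : realType) (n q M k : nat)
    (alpha rho : 'I_k -> R) : Prop :=
  [/\ forall i, -1 < alpha i < 1,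
      forall i j : 'I_k, (i < j)%N -> alpha i < alpha j,
      forall i, 0 < rho i
    & quadrature n q M (2 * k - 1) alpha rho].

Definition levenshtein_even (R : realType) (n q M k : nat)
    (beta gamma : 'I_k.+1 -> R) : Prop :=
  [/\ beta ord0 = -1,
      forall i, beta i < 1,
      forall i j : 'I_k.+1, (i < j)%N -> beta i < beta j,
      forall i, 0 < gamma i
    & quadrature n q M (2 * k) beta gamma].

(* Main.v *)
Require Import Defs.
From HB Require Import structures.
From mathcomp Require Import all_boot all_order all_algebra.
From mathcomp Require Import all_classical all_reals all_analysis.
From mathcomp Require Import ring lra zify.

(** Call a polynomial positive definite when it gives a positive semidefinite
    kernel [f (1 - 2 d(x, y) / n)] on the words. If such an [f] lies below [h] on
    [-1, 1), evaluating the kernel on the indicator of a code [C] of size [M], made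
    orthogonal to the constants, gives [f_0 M - f(1) <= E(C; h)], and the quadrature
    turns the left side into [M] times the sum of the [rho_i f(alpha_i)].

    By Bernstein's theorem the Taylor polynomials of [h] at [-1], which have
    nonnegative coefficients in [1 + t], increase to [h], so [h] may be replaced by
    such a polynomial [T]. Divided differences of [T] are again of this form,
    hence the Hermite interpolant of [T] at the doubled nodes lies below [T] and is
    a nonnegative combination of the products [N_i ^ 2] and [N_i N_(i+1)] of Newton
    polynomials [N_i = (t - alpha_0) ... (t - alpha_(i-1))]. By Schur's product
    theorem it remains to see that [N_i] is positive definite. The quadrature makes
    the Krawtchouk polynomials orthogonal with respect to a positive measure on the
    nodes and 1, and for any such measure the [N_i] are nonnegative combinations of
    the orthogonal polynomials.

    In the even case the same argument runs on words of length [n - 1] with the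
    nodes other than [-1], and multiplication by [t + 1] sends positive definite
    polynomials for length [n - 1] to positive definite ones for length [n]. *)

Set Implicit Arguments.
Unset Strict Implicit.
Unset Printing Implicit Defensive.

Import Order.TTheory GRing.Theory Num.Theory.
Import numFieldNormedType.Exports.

Local Open Scope classical_set_scope.
Local Open Scope ring_scope.

(** * Newton polynomials and discrete orthogonality *)

Definition poly_cone (R : numDomainType) (K : {poly R} -> Prop) : Prop :=
  [/\ K 0, forall f g, K f -> K g -> K (f + g)
    & forall a f, 0 <= a -> K f -> K (a *: f)].

Definition newton (R : nzRingType) (x : nat -> R) (i : nat) : {poly R} :=
  \prod_(j < i) ('X - (x j)%:P).

Lemma newtonS (R : comNzRingType) (x : nat -> R) i :
  newton x i.+1 = newton x i * ('X - (x i)%:P).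
Proof. by rewrite /newton big_ord_recr. Qed.

Lemma newton_root (R : comNzRingType) (x : nat -> R) i j :
  (j < i)%N -> (newton x i).[x j] = 0.
Proof.
move=> ji; rewrite /newton horner_prod (bigD1 (Ordinal ji)) //=.
by rewrite hornerXsubC subrr mul0r.
Qed.

Lemma size_newton (R : idomainType) (x : nat -> R) i : size (newton x i) = i.+1.
Proof. by rewrite /newton size_prod_XsubC /index_enum -enumT size_enum_ord. Qed.

Lemma size_XsubC_mulr (R : idomainType) (a : R) (f : {poly R}) :
  f != 0 -> size (('X - a%:P) * f) = (size f).+1.
Proof.
by move=> f0; rewrite size_mul ?polyXsubC_eq0 // size_XsubC.
Qed.

Lemma poly_cone_sum (R : numDomainType) (K : {poly R} -> Prop) (I : Type)
    (r : seq I) (P : pred I) (F : I -> {poly R}) :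
  poly_cone K -> (forall i, P i -> K (F i)) -> K (\sum_(i <- r | P i) F i).
Proof. by case=> K0 KD _ KF; apply: big_ind. Qed.

Section DiscreteOrthogonality.
Variables (R : realFieldType).
Implicit Types (x w : nat -> R) (f g : {poly R}).

(** Nodes and weights are indexed by [nat], so that dropping the last of the [N + 1] nodes needs no
    reindexing. *)
Definition dot N x w f g : R := \sum_(l < N.+1) w l * f.[x l] * g.[x l].

Lemma dotC N x w f g : dot N x w f g = dot N x w g f.
Proof. by apply: eq_bigr => l _; rewrite mulrAC. Qed.

Lemma dotDl N x w f1 f2 g :
  dot N x w (f1 + f2) g = dot N x w f1 g + dot N x w f2 g.
Proof.
by rewrite /dot -big_split; apply: eq_bigr => l _; rewrite hornerD mulrDr mulrDl.
Qed.

Lemma dotZl N x w a f g : dot N x w (a *: f) g = a * dot N x w f g.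
Proof. by rewrite /dot mulr_sumr; apply: eq_bigr => l _; rewrite hornerZ; ring. Qed.

Lemma dotBl N x w f1 f2 g :
  dot N x w (f1 - f2) g = dot N x w f1 g - dot N x w f2 g.
Proof. by rewrite -scaleN1r dotDl dotZl mulN1r. Qed.

Lemma dot_suml N x w (I : Type) (r : seq I) (F : I -> {poly R}) g :
  dot N x w (\sum_(i <- r) F i) g = \sum_(i <- r) dot N x w (F i) g.
Proof.
elim: r => [|i r IH]; last by rewrite !big_cons dotDl IH.
by rewrite !big_nil /dot big1 // => l _; rewrite horner0 mulr0 mul0r.
Qed.

(** By counting roots. This makes the discrete form definite in low degree. *)
Lemma nonzero_at_node N x f :
  (forall i j, (i < j < N)%N -> x i < x j) -> f != 0 -> (size f <= N)%N ->
  exists l : 'I_N, f.[x l] != 0.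
Proof.
move=> x_lt f0 sf; apply/existsP; apply: contraT => /existsPn H.
suff: (size [seq x (nat_of_ord l) | l <- enum 'I_N] < size f)%N.
  by rewrite size_map size_enum_ord ltnNge sf.
apply: max_poly_roots => //.
  by apply/allP => _ /mapP[l _ ->]; rewrite /root; have := H l; rewrite negbK.
rewrite map_inj_uniq ?enum_uniq // => a b e.
apply/val_inj/eqP; rewrite eqn_leq leqNgt [X in _ && X]leqNgt.
apply/andP; split; apply/negP => lt.
  by have := x_lt b a; rewrite lt ltn_ord e ltxx => /(_ isT).
by have := x_lt a b; rewrite lt ltn_ord e ltxx => /(_ isT).
Qed.

Section Fixed.
Variables (N : nat) (x w : nat -> R) (p : nat -> {poly R}).
Hypothesis x_lt : forall i j, (i < j <= N)%N -> x i < x j.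
Hypothesis w_gt0 : forall i, (i <= N)%N -> 0 < w i.
Hypothesis size_p : forall j, (j <= N)%N -> size (p j) = j.+1.
Hypothesis lead_p : forall j, (j <= N)%N -> 0 < lead_coef (p j).
Hypothesis orth_p :
  forall i j, (i < j <= N)%N -> dot N x w (p i) (p j) = 0.

Let h j := dot N x w (p j) (p j).

Lemma dot_neq i j : (i <= N)%N -> (j <= N)%N -> i != j ->
  dot N x w (p i) (p j) = 0.
Proof.
move=> iN jN; rewrite neq_ltn => /orP[ij|ij]; first by rewrite orth_p ?ij.
by rewrite dotC orth_p ?ij.
Qed.

Lemma sqnorm_gt0 j : (j <= N)%N -> 0 < h j.
Proof.
move=> jN; have pj0 : p j != 0 by rewrite -size_poly_eq0 size_p.
have [||l pl] := @nonzero_at_node N.+1 x (p j) _ pj0; first exact: x_lt.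
  by rewrite size_p.
rewrite /h /dot (bigD1 l) //= ltr_pwDl //.
  rewrite -mulrA mulr_gt0 ?w_gt0 //; first by rewrite -ltnS.
  by rewrite -expr2 lt_def sqr_ge0 expf_neq0.
by apply: sumr_ge0 => i _; rewrite -mulrA mulr_ge0 ?sqr_ge0 // ltW ?w_gt0 // -ltnS.
Qed.

Lemma orth_expansion j f : (j <= N)%N -> (size f <= j.+1)%N ->
  f = \sum_(i < j.+1) (dot N x w f (p i) / h i) *: p i.
Proof.
move=> jN sf.
have [c ->] : exists c : nat -> R, f = \sum_(i < j.+1) c i *: p i.
  elim: j jN f sf => [|j IH] jN f sf.
    exists (fun _ => f`_0 / lead_coef (p 0)); rewrite big_ord1 /=.
    have := lead_p jN; have /eqP := size_p jN; rewrite lead_coefE => /eqP -> /= l0.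
    rewrite [in LHS](size1_polyC sf) [p 0]size1_polyC ?size_p // coefC /=.
    by rewrite -mul_polyC -polyCM divfK // gt_eqF.
  pose a := f`_j.+1 / lead_coef (p j.+1).
  have [|c Hc] := IH (ltnW jN) (f - a *: p j.+1).
    apply/leq_sizeP => m; rewrite leq_eqVlt => /predU1P[<-|lt].
      rewrite coefB coefZ; have := lead_p jN; rewrite /a lead_coefE size_p //= => l0.
      by rewrite divfK ?subrr // gt_eqF.
    rewrite coefB coefZ (nth_default 0 (leq_trans sf lt)).
    by rewrite (@nth_default _ 0 (p j.+1)) ?size_p // mulr0 subr0.
  exists (fun i => if i == j.+1 then a else c i).
  rewrite big_ord_recr /= eqxx -[LHS](subrK (a *: p j.+1)) Hc; congr (_ + _).
  by apply: eq_bigr => i _; rewrite ltn_eqF.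
apply: eq_bigr => i _; congr (_ *: _).
have iN : (i <= N)%N by apply: leq_trans jN; rewrite -ltnS.
rewrite dot_suml (bigD1 i) //= big1 ?addr0; last first.
  move=> m mi; rewrite dotZl dot_neq ?mulr0 //.
  by apply: leq_trans jN; rewrite -ltnS.
by rewrite dotZl -/(h i) mulfK // gt_eqF // sqnorm_gt0.
Qed.

(** The Christoffel-Darboux kernel with one argument fixed at the last node. *)
Definition top_kernel j := \sum_(i < j.+1) ((p i).[x N] / h i) *: p i.

Lemma top_kernel_reproducing j f : (j <= N)%N -> (size f <= j.+1)%N ->
  dot N x w (top_kernel j) f = f.[x N].
Proof.
move=> jN sf; rewrite dot_suml [in RHS](orth_expansion jN sf) horner_sum.
by apply: eq_bigr => i _; rewrite dotZl hornerZ (dotC _ _ _ (p i)); ring.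
Qed.

Lemma size_lead_top_kernel j : (j <= N)%N -> 0 < (p j).[x N] ->
  size (top_kernel j) = j.+1 /\ 0 < lead_coef (top_kernel j).
Proof.
move=> jN pj; rewrite /top_kernel big_ord_recr /= addrC.
have c0 : 0 < (p j).[x N] / h j by rewrite divr_gt0 // sqnorm_gt0.
have s1 : size (((p j).[x N] / h j) *: p j) = j.+1.
  by rewrite size_scale ?size_p // gt_eqF.
have lt : (size (\sum_(i < j) ((p i).[x N] / h i) *: p i)%R <
           size (((p j).[x N] / h j) *: p j)%R)%N.
  rewrite s1 ltnS; apply: (leq_trans (size_sum _ _ _)); apply/bigmax_leqP => i _.
  apply: (leq_trans (size_scale_leq _ _)); rewrite size_p //.
  exact: leq_trans (ltnW (ltn_ord i)) jN.
rewrite size_polyDl // lead_coefDl // lead_coefZ s1; split=> //.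
by rewrite mulr_gt0 // lead_p.
Qed.

(** Let [K] be the kernel of degree [j]. Subtracting a multiple of [p (j + 1)] from [(t - x N) K]
    leaves [G] of degree at most [j], and pairing with [K] gives [G (x N)], a negative multiple of
    [p (j + 1)] at [x N]. The same pairing is negative because [t < x N] at all other nodes. *)
Lemma orth_top_gt0 j : (j <= N)%N -> 0 < (p j).[x N].
Proof.
elim: j => [|j IH] jN.
  have := lead_p jN; rewrite lead_coefE size_p //=.
  by rewrite {2}[p 0]size1_polyC ?size_p // hornerC.
have jN' := ltnW jN.
have [sK lK] := size_lead_top_kernel jN' (IH jN').
set K := top_kernel j in sK lK.
have K0 : K != 0 by rewrite -size_poly_eq0 sK.
pose F := ('X - (x N)%:P) * K.
have sF : size F = j.+2 by rewrite /F size_XsubC_mulr // sK.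
have lF : lead_coef F = lead_coef K by rewrite /F lead_coefM lead_coefXsubC mul1r.
pose a := lead_coef F / lead_coef (p j.+1).
have a0 : 0 < a by rewrite divr_gt0 ?lF ?lead_p.
pose G := F - a *: p j.+1.
have sG : (size G <= j.+1)%N.
  apply/leq_sizeP => m; rewrite leq_eqVlt => /predU1P[<-|lt].
    have := lead_p jN; rewrite coefB coefZ /a !lead_coefE sF size_p //= => l0.
    by rewrite divfK ?subrr // gt_eqF.
  rewrite coefB coefZ nth_default ?sF // (@nth_default _ 0 (p j.+1)) ?size_p //.
  by rewrite mulr0 subr0.
have FK : dot N x w F K < 0.
  (* [K] has degree [j < N], so it cannot vanish at all of the first [N] nodes. *)
  have [||l Kl] := @nonzero_at_node N x K _ K0; last 2 first.
  - by rewrite sK.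
  - rewrite -oppr_gt0 /dot big_ord_recr /= /F !hornerM hornerXsubC subrr mul0r.
    rewrite mulr0 mul0r addr0 -sumrN (bigD1 l) //=.
    have pos (i : 'I_N) : 0 < w i * (x N - x i).
      by rewrite mulr_gt0 ?w_gt0 ?subr_gt0 ?x_lt ?ltn_ord ?leqnn // ltnW.
    have E (i : 'I_N) : - (w i * F.[x i] * K.[x i]) = w i * (x N - x i) * K.[x i] ^+ 2.
      by rewrite /F hornerM hornerXsubC; ring.
    rewrite E ltr_pwDl //; first by rewrite mulr_gt0 // lt_def sqr_ge0 expf_neq0.
    by apply: sumr_ge0 => i _; rewrite E mulr_ge0 ?sqr_ge0 // ltW.
  - by move=> i i' /andP[ii' iN]; rewrite x_lt // ii' ltnW.
have : dot N x w G K < 0.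
  rewrite dotBl dotZl [X in _ - a * X]dotC dot_suml big1 ?mulr0 ?subr0 // => i _.
  by rewrite dotZl orth_p ?mulr0 // jN ltn_ord.
rewrite dotC top_kernel_reproducing // /G /F !hornerE subrr mul0r add0r.
by rewrite oppr_lt0 pmulr_rgt0.
Qed.

(** The reproducing property evaluates a multiple of [X - x N] at [x N]; the degree fits since
    [i + 1 <= j]. *)
Lemma orth_top_kernel i j : (i < j <= N)%N ->
  dot N x w (('X - (x N)%:P) * top_kernel i) (top_kernel j) = 0.
Proof.
case/andP=> ij jN; have iN := ltnW (leq_trans ij jN).
rewrite dotC top_kernel_reproducing //; first by rewrite !hornerE subrr mul0r.
have [s _] := size_lead_top_kernel iN (orth_top_gt0 iN).
by rewrite size_XsubC_mulr ?s // -size_poly_eq0 s.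
Qed.

End Fixed.

(* Induction on the number of nodes: removing the top node [x N] replaces the
   measure by [(x N - t) dm], whose orthogonal polynomials are the kernels
   [top_kernel]; these lie in the cone because [p j] is positive at [x N]. *)
Lemma newton_in_cone (K : {poly R} -> Prop) N x w (p : nat -> {poly R}) :
  poly_cone K ->
  (forall i j, (i < j <= N)%N -> x i < x j) ->
  (forall i, (i <= N)%N -> 0 < w i) ->
  (forall j, (j <= N)%N -> size (p j) = j.+1) ->
  (forall j, (j <= N)%N -> 0 < lead_coef (p j)) ->
  (forall i j, (i < j <= N)%N -> dot N x w (p i) (p j) = 0) ->
  (forall j, (j <= N)%N -> K (p j)) ->
  forall i, (i <= N)%N -> K (newton x i).
Proof.
move=> cK; have [_ _ KZ] := cK.
elim: N w p => [|N IH] w p x_lt w_gt0 size_p lead_p orth_p Kp i iN;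
  have p_gt0 := @orth_top_gt0 _ _ _ _ x_lt w_gt0 size_p lead_p orth_p;
  have sqnorm_gt0 := @sqnorm_gt0 _ _ _ _ x_lt w_gt0 size_p.
  move: iN; rewrite leqn0 => /eqP ->; rewrite /newton big_ord0.
  have c0 := p_gt0 0%N (leqnn _).
  have := Kp 0%N (leqnn _); rewrite [p 0]size1_polyC ?size_p // => /(KZ ((p 0)`_0)^-1).
  have e : (p 0)`_0 = (p 0).[x 0] by rewrite {2}[p 0]size1_polyC ?size_p // hornerC.
  by rewrite scale_polyC mulVf e ?gt_eqF //; apply; rewrite invr_ge0 ltW.
have KK j : (j <= N.+1)%N -> K (top_kernel N.+1 x w p j).
  move=> jN; apply: poly_cone_sum => // l _.
  have lN : (l <= N.+1)%N by apply: leq_trans jN; rewrite -ltnS.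
  by apply: KZ; [rewrite divr_ge0 // ltW ?p_gt0 ?sqnorm_gt0|exact: Kp].
move: iN; rewrite leq_eqVlt => /predU1P[->|iN]; last first.
  apply: (IH (fun l => w l * (x N.+1 - x l)) (top_kernel N.+1 x w p)) => //.
  - by move=> a b /andP[ab bN]; apply: x_lt; rewrite ab ltnW.
  - move=> l lN; rewrite mulr_gt0 ?w_gt0 ?subr_gt0 //; first exact: leqW.
    by apply: x_lt; rewrite ltnS lN leqnn.
  - move=> j jN; have := @size_lead_top_kernel _ _ _ _ x_lt w_gt0 size_p lead_p j.
    by case=> //; [exact: leqW|apply: p_gt0; exact: leqW].
  - move=> j jN; have := @size_lead_top_kernel _ _ _ _ x_lt w_gt0 size_p lead_p j.
    by case=> //; [exact: leqW|apply: p_gt0; exact: leqW].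
  - move=> a b /andP[ab bN].
    have := @orth_top_kernel _ _ _ _ x_lt w_gt0 size_p lead_p orth_p a b.
    rewrite ab leqW // => /(_ isT) /eqP.
    rewrite /dot big_ord_recr /= hornerM hornerXsubC subrr mul0r mulr0 mul0r addr0.
    (* The kernels are orthogonal for the factor [t - x (N + 1)]; its sign is flipped to make the
       measure positive. *)
    rewrite -oppr_eq0 -sumrN => /eqP H; apply: etrans H; apply: eq_bigr => l _.
    by rewrite hornerM hornerXsubC; ring.
  - by move=> j jN; apply: KK; exact: leqW.
(* [newton x (N + 1)] vanishes at every node but the last, where it and the [p j] are positive, so
   its coefficients in the orthogonal basis are nonnegative. *)
rewrite (orth_expansion x_lt w_gt0 size_p lead_p orth_p (leqnn _)
  (eq_leq (size_newton x N.+1))).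
apply: poly_cone_sum => // j _; have jN : (j <= N.+1)%N by rewrite -ltnS.
apply: KZ; last exact: Kp.
apply: divr_ge0; last by rewrite ltW ?sqnorm_gt0.
rewrite /dot big_ord_recr /= big1 ?add0r; last first.
  by move=> l _; rewrite newton_root ?ltn_ord // mulr0 mul0r.
apply: mulr_ge0; last by rewrite ltW ?p_gt0.
apply: mulr_ge0; first by rewrite ltW ?w_gt0.
rewrite /newton horner_prod; apply: prodr_ge0 => l _.
by rewrite hornerXsubC subr_ge0 ltW // x_lt // ltn_ord leqnn.
Qed.

End DiscreteOrthogonality.

(** * Gram kernels and the Krawtchouk kernels *)

Section Gram.
Variables (R : rcfType) (T : Type).
Implicit Types k : T -> T -> R.

(** A positive semidefinite kernel given as a finite sum of rank-one kernels, a form from which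
    closure under sums and products can be read off. *)
Definition gram k : Prop :=
  exists s : seq (T -> R), forall x y, k x y = \sum_(v <- s) v x * v y.

Lemma gram_ext k1 k2 : (forall x y, k1 x y = k2 x y) -> gram k1 -> gram k2.
Proof. by move=> e [s hs]; exists s => x y; rewrite -e. Qed.

Lemma gram_rank1 (v : T -> R) : gram (fun x y => v x * v y).
Proof. by exists [:: v] => x y; rewrite big_seq1. Qed.

Lemma gram0 : gram (fun _ _ => 0).
Proof. by exists [::] => x y; rewrite big_nil. Qed.

Lemma gramD k1 k2 : gram k1 -> gram k2 -> gram (fun x y => k1 x y + k2 x y).
Proof. by move=> [s hs] [t ht]; exists (s ++ t) => x y; rewrite big_cat hs ht. Qed.

(** Schur's product theorem: the products [u v] of the terms of both factors represent the
    product. *)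
Lemma gramM k1 k2 : gram k1 -> gram k2 -> gram (fun x y => k1 x y * k2 x y).
Proof.
move=> [s hs] [t ht]; exists [seq (fun x => u x * v x) | u <- s, v <- t] => x y.
rewrite big_allpairs_dep hs ht mulr_suml; apply: eq_bigr => u _.
by rewrite mulr_sumr; apply: eq_bigr => v _; rewrite mulrACA.
Qed.

Lemma gram_cst a : 0 <= a -> gram (fun _ _ => a).
Proof.
move=> a0; apply: gram_ext (gram_rank1 (fun _ => Num.sqrt a)) => x y.
by rewrite -expr2 sqr_sqrtr.
Qed.

Lemma gram_sum (I : Type) (r : seq I) (P : pred I) (F : I -> T -> T -> R) :
  (forall i, P i -> gram (F i)) -> gram (fun x y => \sum_(i <- r | P i) F i x y).
Proof.
move=> gF; elim: r => [|i r IH].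
  by apply: gram_ext gram0 => x y; rewrite big_nil.
have [Pi|nPi] := boolP (P i).
  by apply: gram_ext (gramD (gF i Pi) IH) => x y; rewrite big_cons Pi.
by apply: gram_ext IH => x y; rewrite big_cons (negPf nPi).
Qed.

Lemma gram_prod (I : Type) (r : seq I) (P : pred I) (F : I -> T -> T -> R) :
  (forall i, P i -> gram (F i)) -> gram (fun x y => \prod_(i <- r | P i) F i x y).
Proof.
move=> gF; elim: r => [|i r IH].
  by apply: gram_ext (gram_cst ler01) => x y; rewrite big_nil.
have [Pi|nPi] := boolP (P i).
  by apply: gram_ext (gramM (gF i Pi) IH) => x y; rewrite big_cons Pi.
by apply: gram_ext IH => x y; rewrite big_cons (negPf nPi).
Qed.

End Gram.

Lemma gram_comp (R : rcfType) (S T : Type) (g : S -> T) (k : T -> T -> R) :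
  gram k -> gram (fun x y => k (g x) (g y)).
Proof.
by move=> [s hs]; exists [seq v \o g | v <- s] => x y; rewrite big_map hs.
Qed.

Lemma gram_ge0 (R : rcfType) (T : finType) (k : T -> T -> R) (c : T -> R) :
  gram k -> 0 <= \sum_x \sum_y c x * c y * k x y.
Proof.
move=> [s hs].
suff -> : \sum_x \sum_y c x * c y * k x y = \sum_(v <- s) (\sum_x c x * v x) ^+ 2.
  by apply: sumr_ge0 => v _; rewrite sqr_ge0.
under eq_bigr => x _ do under eq_bigr => y _ do rewrite hs mulr_sumr.
under eq_bigr => x _ do rewrite exchange_big.
rewrite exchange_big; apply: eq_bigr => v _.
rewrite expr2 mulr_suml; apply: eq_bigr => x _.
by rewrite mulr_sumr; apply: eq_bigr => y _; rewrite mulrACA.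
Qed.

Lemma sum_delta (R : nzRingType) (T : finType) (x : T) (F : T -> R) :
  \sum_a (x == a)%:R * F a = F x.
Proof.
rewrite (bigD1 x) //= eqxx mul1r big1 ?addr0 // => a; rewrite eq_sym => /negPf ->.
by rewrite mul0r.
Qed.

(* The scale [s] is kept apart from the length [n] because the even case uses words
   of length [n - 1] with the variable [t = 1 - 2 d / n]. *)
Definition posdef (R : rcfType) n q (s : R) (f : {poly R}) : Prop :=
  gram (fun x y : hamming_space n q => f.[1 - 2 * (hamming_dist x y)%:R / s]).

Lemma posdef_cone (R : rcfType) n q (s : R) : poly_cone (@posdef R n q s).
Proof.
split=> [|f g Kf Kg|a f a0 Kf].
- by apply: gram_ext (@gram0 _ _) => x y; rewrite horner0.
- by apply: gram_ext (gramD Kf Kg) => x y; rewrite hornerD.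
- by apply: gram_ext (gramM (gram_cst _ a0) Kf) => x y; rewrite hornerZ.
Qed.

Lemma posdefM (R : rcfType) n q (s : R) f g :
  @posdef R n q s f -> @posdef R n q s g -> @posdef R n q s (f * g).
Proof. by move=> Kf Kg; apply: gram_ext (gramM Kf Kg) => x y; rewrite hornerM. Qed.

Section Krawtchouk.
Variables (R : rcfType) (n q : nat).
Hypothesis q_gt0 : (0 < q)%N.
Local Notation H := (hamming_space n q).

(** The matrix [q I - J], with [J] the all-ones matrix: [q] times the projection onto the vectors of
    sum zero. *)
Definition centered_match (a b : 'I_q) : R := q%:R * (a == b)%:R - 1.

Lemma centered_match_sum a : \sum_b centered_match a b = 0.
Proof.
rewrite sumrB; under eq_bigr => b _ do rewrite mulrC.
by rewrite sum_delta sumr_const card_ord subrr.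
Qed.

(** [A = q I - J] is symmetric with [A ^ 2 = q A], so its entries are [1 / q] times the inner
    products of its rows. *)
Lemma gram_centered_match : gram centered_match.
Proof.
have q0 : q%:R != 0 :> R by rewrite pnatr_eq0 -lt0n.
have := gramM (@gram_cst R 'I_q q%:R^-1 _)
  (@gram_sum R _ _ (index_enum 'I_q) xpredT _
     (fun c _ => gram_rank1 (fun a => centered_match a c))).
rewrite invr_ge0 ler0n => /(_ isT); apply: gram_ext => a b.
rewrite /centered_match.
under eq_bigr => c _ do rewrite mulrBl mulrBr mul1r mulr1 -!mulrA.
rewrite !sumrB -!mulr_sumr.
rewrite (sum_delta a (fun c => q%:R * (b == c)%:R)) sumr_const card_ord.
have e c : \sum_d (c == d)%:R = 1 :> R.
  by under eq_bigr => d _ do rewrite -[_%:R]mulr1; exact: sum_delta.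
rewrite !e (eq_sym b); field.
by rewrite q0.
Qed.

Definition subset_match (S : {set 'I_n}) (x y : H) : R :=
  \prod_(c in S) centered_match (x c) (y c).

Lemma gram_subset_match S : gram (subset_match S).
Proof.
apply: gram_prod => c _.
exact: (gram_comp (fun x : H => x c) gram_centered_match).
Qed.

(** The sum factors over the coordinates, and a coordinate in exactly one of [S] and [T] contributes
    a vanishing row sum. *)
Lemma subset_match_orth S T x : S != T ->
  \sum_y subset_match S x y * subset_match T x y = 0.
Proof.
move=> ST.
pose G c b := (if c \in S then centered_match (x c) b else 1) *
              (if c \in T then centered_match (x c) b else 1).
have -> : \sum_y subset_match S x y * subset_match T x y =
          \sum_(y : H) \prod_c G c (y c).
  by apply: eq_bigr => y _; rewrite big_split -!big_mkcond.
rewrite -bigA_distr_bigA.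
have [c cST] : exists c, (c \in S) != (c \in T).
  apply/existsP; apply: contraR ST => /existsPn h; apply/eqP/setP => c.
  by apply/eqP; have := h c; rewrite negbK.
rewrite (bigD1 c) //= /G; case: (c \in S) (c \in T) cST => [] [] //= _.
  by under eq_bigr => b _ do rewrite mulr1; rewrite centered_match_sum mul0r.
by under eq_bigr => b _ do rewrite mul1r; rewrite centered_match_sum mul0r.
Qed.

(** The unnormalized Krawtchouk polynomial [K_j] at the distance of [x] and [y], in a form that is
    visibly positive semidefinite. *)
Definition krawtchouk_kernel j (x y : H) : R :=
  \sum_(S : {set 'I_n} | #|S| == j) subset_match S x y.

Lemma gram_krawtchouk j : gram (krawtchouk_kernel j).
Proof. by apply: gram_sum => S _; exact: gram_subset_match. Qed.

Lemma krawtchouk_orth i j x : i != j ->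
  \sum_y krawtchouk_kernel i x y * krawtchouk_kernel j x y = 0.
Proof.
move=> ij.
under eq_bigr => y _ do rewrite mulr_suml.
rewrite exchange_big big1 // => S /eqP Si.
under eq_bigr => y _ do rewrite mulr_sumr.
rewrite exchange_big big1 // => T /eqP Tj.
by apply: subset_match_orth; apply: contra_neq ij => ST; rewrite -Si -Tj ST.
Qed.

Lemma hamming_dist_le (x y : H) : (hamming_dist x y <= n)%N.
Proof. by rewrite /hamming_dist -[leqRHS]card_ord max_card. Qed.

Lemma prod_match (x y : H) (A : comNzRingType) (a b : A) :
  \prod_c (if x c == y c then a else b) =
  a ^+ (n - hamming_dist x y) * b ^+ hamming_dist x y.
Proof.
rewrite (bigID (fun c => x c == y c)) /=; congr (_ * _).
  rewrite (eq_bigr (fun _ => a)); last by move=> c ->.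
  rewrite prodr_const; congr (_ ^+ _); rewrite /hamming_dist.
  rewrite -[X in (X - _)%N](card_ord n) -(cardsC [set c | x c != y c]%SET) addKn.
  apply: eq_card => c.
  by rewrite !inE negbK.
rewrite (eq_bigr (fun _ => b)); last by move=> c /negPf ->.
by rewrite prodr_const; congr (_ ^+ _); apply: eq_card => c; rewrite inE.
Qed.

(** Expanding the product of the factors [1 + centered_match X] by subsets of coordinates yields the
    kernel; each factor is [1 + (q - 1) X] or [1 - X]. *)
Lemma krawtchouk_gen j (x y : H) :
  krawtchouk_kernel j x y =
  ((1 + (q%:R - 1) *: 'X) ^+ (n - hamming_dist x y) *
   (1 - 'X) ^+ hamming_dist x y : {poly R})`_j.
Proof.
rewrite -prod_match.
transitivity ((\prod_c ((centered_match (x c) (y c)) *: 'X + 1 : {poly R}))`_j).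
  rewrite bigA_distr coef_sum /krawtchouk_kernel big_mkcond; apply: eq_bigr => S _.
  rewrite -big_mkcond /= scaler_prod.
  rewrite prodr_const coefZ coefXn eq_sym; case: ifP => _; by rewrite ?mulr1 ?mulr0.
congr ((polyseq _)`_j); apply: eq_bigr => c _; rewrite /centered_match.
by case: eqP => _; rewrite ?mulr1 ?mulr0 ?sub0r ?scaleN1r addrC.
Qed.

End Krawtchouk.

(** * Krawtchouk polynomials *)

(** A sum over all words, grouped by the distance [z] from a fixed one; for [s = n] it is
    [q ^ n f_0]. *)
Definition binomial_mean (R : rcfType) n q (s : R) (f : {poly R}) : R :=
  \sum_(z < n.+1) ('C(n, z) * q.-1 ^ z)%:R * f.[1 - 2 * z%:R / s].

Lemma sum_hamming_dist (R : rcfType) n q (q_gt0 : (0 < q)%N) (phi : nat -> R)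
    (x : hamming_space n q) :
  \sum_y phi (hamming_dist x y) =
  \sum_(z < n.+1) ('C(n, z) * q.-1 ^ z)%:R * phi z.
Proof.
have distE y : phi (hamming_dist x y) =
    \sum_(z < n.+1) ('X^(hamming_dist x y) : {poly R})`_z * phi z.
  have lt : (hamming_dist x y < n.+1)%N by rewrite ltnS hamming_dist_le.
  rewrite (bigD1 (Ordinal lt)) //= coefXn eqxx mul1r big1 ?addr0 // => z zd.
  rewrite coefXn; case: eqP => [e|_]; last by rewrite mul0r.
  by case/eqP: zd; apply: val_inj.
under eq_bigr => y _ do rewrite distE.
rewrite exchange_big; apply: eq_bigr => z _; rewrite -mulr_suml -coef_sum.
congr (_ * _).
(* The sum of [X ^ d(x, y)] over [y] factors over the coordinates, each with one match and [q - 1]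
   mismatches. *)
have -> : \sum_y 'X^(hamming_dist x y) = (1 + q.-1%:R *: 'X : {poly R}) ^+ n.
  under eq_bigr => y _.
    rewrite -['X^_]mul1r -(expr1n _ (n - hamming_dist x y)) -prod_match; over.
  rewrite /= -(bigA_distr_bigA (fun c b => if x c == b then 1 else 'X)).
  rewrite (eq_bigr (fun _ => 1 + q.-1%:R *: 'X)); first by rewrite prodr_const card_ord.
  move=> c _; rewrite (bigD1 (x c)) //= eqxx; congr (_ + _).
  rewrite (eq_bigr (fun _ => 'X)) => [|b]; last by rewrite eq_sym => /negPf ->.
  rewrite sumr_const scaler_nat; congr (_ *+ _).
  by have := cardC1 (x c); rewrite card_ord => <-; apply: eq_card => b; rewrite inE.
rewrite exprDn coef_sum (bigD1 z) //= expr1n mul1r exprZn coefMn coefZ coefXn eqxx.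
rewrite mulr1 big1 ?addr0 => [|i iz]; first by rewrite natrM natrX mulr_natl.
rewrite expr1n mul1r exprZn coefMn coefZ coefXn.
case: eqP => [e|_]; last by rewrite mulr0 mul0rn.
by case/eqP: iz; apply: val_inj.
Qed.

Section KrawtchoukPolynomial.
Variables (R : rcfType) (n q : nat) (s : R).
Hypotheses (q_gt0 : (0 < q)%N) (s_gt0 : 0 < s).

Lemma prod_natrB (a i : nat) : \prod_(l < i) (a%:R - l%:R) = (a ^_ i)%:R :> R.
Proof.
elim: i => [|i IH]; first by rewrite big_ord0.
rewrite big_ord_recr /= IH ffactnSr natrM.
have [ia|ai] := leqP i a; first by rewrite natrB.
by rewrite ffact_small // !mul0r.
Qed.

(* The polynomial in [t = 1 - 2 d / s] taking the value ['C(n - d, i)]. *)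
Definition binomial_poly (i : nat) : {poly R} :=
  (i`!%:R^-1 * (s / 2) ^+ i) *: newton (fun l => 1 - 2 * (n%:R - l%:R) / s) i.

Lemma binomial_polyE i d : (d <= n)%N ->
  (binomial_poly i).[1 - 2 * d%:R / s] = 'C(n - d, i)%:R.
Proof.
move=> dn; rewrite hornerZ /newton horner_prod -(mulrA i`!%:R^-1).
have -> : (s / 2) ^+ i = \prod_(l < i) (s / 2) by rewrite prodr_const card_ord.
rewrite -big_split /=.
rewrite (eq_bigr (fun l : 'I_i => (n - d)%:R - l%:R)) => [|l _]; last first.
  by rewrite hornerXsubC natrB //; field; rewrite gt_eqF.
by rewrite prod_natrB -bin_ffact natrM mulrC mulfK // pnatr_eq0 -lt0n fact_gt0.
Qed.

(** These come from writing [1 + (q - 1) X = (1 - X) + q X] in the generating function, after which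
    the distance enters only through ['C(n - d, i)]. *)
Definition krawtchouk_coef j i : R := ('X^i * (1 - 'X) ^+ (n - i))`_j.

Lemma krawtchouk_coef_gt j i : (j < i)%N -> krawtchouk_coef j i = 0.
Proof. by move=> ji; rewrite /krawtchouk_coef coefXnM ji. Qed.

Lemma krawtchouk_coef_diag j : krawtchouk_coef j j = 1.
Proof.
rewrite /krawtchouk_coef coefXnM ltnn subnn -horner_coef0 horner_exp !hornerE.
by rewrite subr0 expr1n.
Qed.

Definition krawtchouk_poly j : {poly R} :=
  \sum_(i < j.+1) (krawtchouk_coef j i * q%:R ^+ i) *: binomial_poly i.

Lemma krawtchouk_polyE j (x y : hamming_space n q) :
  (krawtchouk_poly j).[1 - 2 * (hamming_dist x y)%:R / s] =
  krawtchouk_kernel R j x y.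
Proof.
have dn := hamming_dist_le x y; rewrite krawtchouk_gen.
move: (hamming_dist x y) dn => d dn.
pose F i := krawtchouk_coef j i * q%:R ^+ i * 'C(n - d, i)%:R.
transitivity (\sum_(i < j.+1) F i).
  by rewrite horner_sum; apply: eq_bigr => i _; rewrite hornerZ binomial_polyE.
(* [F i] vanishes beyond either bound, so both sums extend to a common range. *)
transitivity (\sum_(i < (n - d).+1) F i).
  have Fj i : (j.+1 <= i)%N -> F i = 0.
    by move=> ji; rewrite /F krawtchouk_coef_gt // !mul0r.
  have Fn i : ((n - d).+1 <= i)%N -> F i = 0.
    by move=> ni; rewrite /F bin_small // mulr0.
  have full m k : (forall i, (m <= i)%N -> F i = 0) ->
      \sum_(i < m) F i = \sum_(i < m + k) F i.
    move=> F0; rewrite (big_ord_widen _ F (leq_addr k m)) big_mkcond.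
    by apply: eq_bigr => i _; case: ltnP => // /F0.
  by rewrite (full _ (n - d).+1 Fj) (full _ j.+1 Fn) addnC.
have -> : 1 + (q%:R - 1) *: 'X = (1 - 'X) + q%:R *: 'X :> {poly R}.
  by rewrite scalerBl scale1r [_ - 'X]addrC addrA.
rewrite exprDn mulr_suml coef_sum; apply: eq_bigr => i _.
have iN : (i <= n - d)%N by rewrite -ltnS.
rewrite mulrnAl coefMn /F /krawtchouk_coef -[RHS]mulr_natr; congr (_ * _).
rewrite exprZn mulrAC -exprD -scalerAr coefZ mulrC; congr (_ * (polyseq _)`_j).
have -> : (n - d - i + d = n - i)%N by lia.
exact: mulrC.
Qed.

Lemma size_lead_binomial_poly i :
  size (binomial_poly i) = i.+1 /\ 0 < lead_coef (binomial_poly i).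
Proof.
have c0 : 0 < i`!%:R^-1 * (s / 2) ^+ i.
  by rewrite mulr_gt0 ?invr_gt0 ?ltr0n ?fact_gt0 // exprn_gt0 // divr_gt0.
rewrite size_scale ?gt_eqF // size_newton lead_coefZ; split=> //.
by rewrite mulr_gt0 // (monicP (monic_prod_XsubC _ _ _)).
Qed.

(** The top term has coefficient [q ^ j > 0]. The degree is thus [j] even for [j > n], where the
    polynomial vanishes at all distances. *)
Lemma size_lead_krawtchouk_poly j :
  size (krawtchouk_poly j) = j.+1 /\ 0 < lead_coef (krawtchouk_poly j).
Proof.
have [sB lB] := size_lead_binomial_poly j.
have c0 : 0 < krawtchouk_coef j j * q%:R ^+ j :> R.
  by rewrite krawtchouk_coef_diag mul1r exprn_gt0 // ltr0n.
rewrite /krawtchouk_poly big_ord_recr /= addrC.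
set B := (_ *: _); set S := \sum_(i < j) _.
have sj : size B = j.+1 by rewrite size_scale // gt_eqF.
have lt : (size S < size B)%N.
  rewrite sj ltnS; apply: (leq_trans (size_sum _ _ _)); apply/bigmax_leqP => i _.
  apply: (leq_trans (size_scale_leq _ _)).
  by have [-> _] := size_lead_binomial_poly i.
by rewrite size_polyDl // lead_coefDl // lead_coefZ sj mulr_gt0.
Qed.

Lemma posdef_krawtchouk_poly j : posdef n q s (krawtchouk_poly j).
Proof.
by apply: gram_ext (gram_krawtchouk _ _ q_gt0 j) => x y; rewrite krawtchouk_polyE.
Qed.

Lemma krawtchouk_poly_orth i j : i != j ->
  binomial_mean n q s (krawtchouk_poly i * krawtchouk_poly j) = 0.
Proof.
move=> ij; pose x0 : hamming_space n q := [ffun => Ordinal q_gt0].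
apply: etrans (krawtchouk_orth R x0 ij).
apply: etrans (esym (sum_hamming_dist q_gt0
  (fun d => (krawtchouk_poly i * krawtchouk_poly j).[1 - 2 * d%:R / s]) x0)) _.
by apply: eq_bigr => y _; rewrite hornerM !krawtchouk_polyE.
Qed.

(** Exactness up to degree [2 N - 1] covers the products of the Krawtchouk polynomials of degrees
    [i < j <= N], which are therefore orthogonal on the nodes. *)
Lemma posdef_newton N (x w : nat -> R) :
  (forall i j, (i < j <= N)%N -> x i < x j) ->
  (forall i, (i <= N)%N -> 0 < w i) ->
  (forall f : {poly R}, (size f <= 2 * N)%N ->
     binomial_mean n q s f = \sum_(l < N.+1) w l * f.[x l]) ->
  forall i, (i <= N)%N -> posdef n q s (newton x i).
Proof.
move=> x_lt w_gt0 quad; apply: (@newton_in_cone R _ N x w krawtchouk_poly) => //.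
- exact: posdef_cone.
- by move=> j _; have [] := size_lead_krawtchouk_poly j.
- by move=> j _; have [] := size_lead_krawtchouk_poly j.
- move=> i j /andP[ij jN]; rewrite -(@krawtchouk_poly_orth i j) ?ltn_eqF //.
  rewrite quad; last first.
    have [si _] := size_lead_krawtchouk_poly i.
    have [sj _] := size_lead_krawtchouk_poly j.
    apply: leq_trans (size_polyMleq _ _) _; rewrite si sj addSn /= addnS.
    by rewrite mul2n -addnn -addSn leq_add // (leq_trans ij).
  by apply: eq_bigr => l _; rewrite hornerM mulrA.
- by move=> j _; exact: posdef_krawtchouk_poly.
Qed.

End KrawtchoukPolynomial.

Lemma hamming_distE n q (x y : hamming_space n q) :
  hamming_dist x y = (\sum_c (x c != y c))%N.
Proof.
rewrite /hamming_dist -sum1_card big_mkcond; apply: eq_bigr => c _.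
by rewrite inE; case: (x c != y c).
Qed.

(* [n - d(x, y)] is the number of coordinates [c] with [x c = y c], and for such
   a [c] the distance [d(x, y)] is that of the words with [c] deleted. *)
Lemma posdef_lift (R : rcfType) n q (s : R) (f : {poly R}) :
  posdef n q s f ->
  gram (fun x y : hamming_space n.+1 q => (n.+1 - hamming_dist x y)%:R *
    f.[1 - 2 * (hamming_dist x y)%:R / s]).
Proof.
move=> Kf.
pose del c (x : hamming_space n.+1 q) : hamming_space n q := [ffun i => x (lift c i)].
have := @gram_sum R _ _ (index_enum 'I_n.+1) xpredT _ (fun c _ => gramM
  (@gram_sum R _ _ (index_enum 'I_q) xpredT _
     (fun a _ => gram_rank1 (fun x : hamming_space n.+1 q => (x c == a)%:R)))
  (gram_comp (del c) Kf)).
apply: gram_ext => x y.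
rewrite (eq_bigr (fun c => (x c == y c)%:R * f.[1 - 2 * (hamming_dist x y)%:R / s])).
  rewrite -mulr_suml -natr_sum; congr (_%:R * _).
  rewrite hamming_distE -[X in (X - _)%N](card_ord n.+1) -sum1_card -sumnB.
    by apply: eq_bigr => c _; case: eqP.
  by move=> c _; case: (x c != y c).
move=> c _; rewrite (sum_delta (x c) (fun a => (y c == a)%:R)) eq_sym.
case: eqP => [xy|_]; last by rewrite !mul0r.
congr (_ * f.[1 - 2 * _%:R / s]).
rewrite !hamming_distE [RHS](bigD1_ord c) //= xy eqxx add0n.
by apply: eq_bigr => i _; rewrite !ffunE.
Qed.

(** * Energy bounds for positive definite polynomials *)

Lemma hamming_distC n q (x y : hamming_space n q) : hamming_dist x y = hamming_dist y x.
Proof. by rewrite !hamming_distE; apply: eq_bigr => c _; rewrite eq_sym. Qed.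

Lemma hamming_dist0 n q (x : hamming_space n q) : hamming_dist x x = 0%N.
Proof. by rewrite hamming_distE big1 // => c _; rewrite eqxx. Qed.

Lemma hamming_inner_itv (R : realType) n q (x y : hamming_space n q) :
  (0 < n)%N -> x != y -> -1 <= hamming_inner R x y < 1.
Proof.
move=> n_gt0 xy; have n0 : 0 < n%:R :> R by rewrite ltr0n.
have d0 : (0 < hamming_dist x y)%N.
  rewrite lt0n; apply: contra_neqN xy; rewrite hamming_distE sum_nat_eq0.
  move/forall_inP => h; apply/ffunP => c; apply/eqP.
  by have := h c isT; case: (x c == y c).
have dn := hamming_dist_le x y.
rewrite /hamming_inner; apply/andP; split.
  have : (hamming_dist x y)%:R / n%:R <= 1 :> R by rewrite ler_pdivrMr // mul1r ler_nat.
  by lra.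
have : 0 < (hamming_dist x y)%:R / n%:R :> R by rewrite divr_gt0 // ltr0n.
by lra.
Qed.

Section CodeBound.
Variables (R : realType) (n q : nat).
Hypotheses (n_gt0 : (0 < n)%N) (q_gt0 : (0 < q)%N).
Local Notation H := (hamming_space n q).

(* Apply positive semidefiniteness to [1_C - |C| / q ^ n], which is orthogonal
   to the constants. *)
Lemma posdef_code_sum (F : {poly R}) (C : {set H}) : posdef n q n%:R F ->
  zeroth_coef n q F * #|C|%:R ^+ 2 <=
    \sum_(x in C) \sum_(y in C) F.[hamming_inner R x y].
Proof.
move=> pF; pose k (x y : H) := F.[hamming_inner R x y].
pose Q : R := (q ^ n)%:R; pose m : R := #|C|%:R.
have Q0 : Q != 0 by rewrite pnatr_eq0 expn_eq0 negb_and -lt0n q_gt0.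
(* The row sums agree because the distribution of distances from a word does not depend on the
   word. *)
have sumk x : \sum_y k x y = Q * zeroth_coef n q F.
  rewrite /zeroth_coef mulVKf //.
  exact: (sum_hamming_dist q_gt0 (fun d => F.[1 - 2 * d%:R / n%:R]) x).
have kC x y : k x y = k y x by rewrite /k /hamming_inner hamming_distC.
pose c (x : H) : R := (x \in C)%:R - m / Q.
have sumc : \sum_x c x = 0.
  rewrite sumrB sumr_const card_ffun !card_ord -natr_sum.
  have -> : (\sum_(x : H) (x \in C) = #|C|)%N.
    by rewrite -sum1_card [RHS]big_mkcond; apply: eq_bigr => x _; case: (x \in C).
  by rewrite -[X in _ - X]mulr_natr divfK // subrr.
have := gram_ge0 c pF; rewrite -subr_ge0 => h.
rewrite -subr_ge0; apply: le_trans h _.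
rewrite subr0 le_eqVlt; apply/orP; left; apply/eqP.
transitivity (\sum_x c x * \sum_(y in C) k x y).
  transitivity (\sum_x c x * (\sum_(y in C) k x y - m * zeroth_coef n q F)).
    apply: eq_bigr => x _; under eq_bigr => y _ do rewrite -mulrA.
    rewrite -mulr_sumr; congr (_ * _).
    rewrite /c; under eq_bigr => y _ do rewrite mulrBl.
    rewrite sumrB -mulr_sumr (sumk x); congr (_ - _).
      rewrite [RHS]big_mkcond; apply: eq_bigr => y _.
      by case: (y \in C); rewrite ?mul1r ?mul0r.
    by rewrite mulrA divfK.
  under eq_bigr => x _ do rewrite mulrBr.
  by rewrite sumrB -mulr_suml sumc mul0r subr0.
rewrite /c; under eq_bigr => x _ do rewrite mulrBl.
rewrite sumrB; congr (_ - _).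
  rewrite [RHS]big_mkcond; apply: eq_bigr => y _.
  by case: (y \in C); rewrite ?mul1r ?mul0r.
rewrite -mulr_sumr exchange_big.
under eq_bigr => y _ do (under eq_bigr => x _ do rewrite kC; rewrite sumk).
rewrite sumr_const -[X in _ * X]mulr_natr -/m; field.
by [].
Qed.

(** The diagonal contributes [|C| F(1)], and off the diagonal [F] is bounded by [h]. *)
Lemma energy_ge (h : R -> R) (F : {poly R}) (C : {set H}) : (0 < #|C|)%N ->
  posdef n q n%:R F -> (forall t, -1 <= t < 1 -> F.[t] <= h t) ->
  zeroth_coef n q F * #|C|%:R - F.[1] <= energy h C.
Proof.
move=> C0 pF Fh; have m0 : 0 < #|C|%:R :> R by rewrite ltr0n.
rewrite /energy -(ler_pM2l m0) mulVKf ?gt_eqF //.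
have := posdef_code_sum C pF.
have -> : \sum_(x in C) \sum_(y in C) F.[hamming_inner R x y] =
    #|C|%:R * F.[1] + \sum_(x in C) \sum_(y in C | x != y) F.[hamming_inner R x y].
  rewrite mulr_natl -sumr_const -big_split; apply: eq_bigr => x xC /=.
  rewrite (bigD1 x) //= /hamming_inner hamming_dist0 mulr0 mul0r subr0; congr (_ + _).
  by apply: eq_bigl => y; rewrite eq_sym.
have : \sum_(x in C) \sum_(y in C | x != y) F.[hamming_inner R x y] <=
       \sum_(x in C) \sum_(y in C | x != y) h (hamming_inner R x y).
  apply: ler_sum => x _; apply: ler_sum => y /andP[_ xy].
  by apply: Fh; exact: hamming_inner_itv.
by set a := \sum_(x in C) _; set b := \sum_(x in C) _; set z := zeroth_coef _ _ _; nra.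
Qed.

End CodeBound.

(** * Hermite interpolation at doubled nodes *)

Section Hermite.
Variable R : realType.

(** Polynomials with nonnegative coefficients in the powers of [1 + t], in Horner form. *)
Inductive nonneg_at_m1 : {poly R} -> Prop :=
| nonneg_at_m1_0 : nonneg_at_m1 0
| nonneg_at_m1_S c T : 0 <= c -> nonneg_at_m1 T ->
    nonneg_at_m1 (c%:P + ('X + 1) * T).

Lemma nonneg_at_m1_ge0 T t : nonneg_at_m1 T -> -1 <= t -> 0 <= T.[t].
Proof.
move=> AT t1; elim: AT => [|c {}T c0 _ IH]; first by rewrite horner0.
by rewrite !hornerE addr_ge0 // mulr_ge0 // -[1]opprK subr_ge0.
Qed.

(** Along the Horner form: if [T] has quotient [T1], then [c + (X + 1) T] has quotient
    [T(x) + (X + 1) T1], and [T(x) >= 0] since [x >= -1]. *)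
Lemma nonneg_at_m1_divdiff T x : nonneg_at_m1 T -> -1 <= x ->
  exists2 T1, nonneg_at_m1 T1 & T = T.[x]%:P + ('X - x%:P) * T1.
Proof.
move=> AT x1; elim: AT => [|c {}T c0 AT [T1 AT1 eT]].
  by exists 0; [exact: nonneg_at_m1_0|rewrite horner0 mulr0 addr0].
exists (T.[x]%:P + ('X + 1) * T1).
  by apply: nonneg_at_m1_S => //; exact: nonneg_at_m1_ge0.
rewrite {1}eT !hornerE !(polyCD, polyCM); ring.
Qed.

(* Newton's form of the Hermite interpolant of [T] at the doubled nodes. *)
Lemma hermite_decomposition (K : {poly R} -> Prop) (x : nat -> R) N T :
  poly_cone K -> (forall i, (i < N)%N -> -1 <= x i) ->
  (forall i, (i < N)%N -> K (newton x i ^+ 2)) ->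
  (forall i, (i < N)%N -> K (newton x i * newton x i.+1)) ->
  nonneg_at_m1 T ->
  exists F T', [/\ K F, (size F <= 2 * N)%N, nonneg_at_m1 T'
    & T = F + newton x N ^+ 2 * T'].
Proof.
move=> cK x1 K1 K2 AT; have [K0 KD KZ] := cK.
elim: N x1 K1 K2 => [|N IH] x1 K1 K2.
  exists 0, T; split => //; first by rewrite size_poly0.
  by rewrite /newton big_ord0 expr1n mul1r add0r.
have [|||F [T' [KF sF AT' eT]]] := IH.
- by move=> i iN; apply/x1/ltnW.
- by move=> i iN; apply/K1/ltnW.
- by move=> i iN; apply/K2/ltnW.
have xN := x1 N (leqnn _).
(* Dividing the remainder twice at [x N] yields the two new Newton coefficients [T'(x N)] and
   [T1(x N)], both nonnegative. *)
have [T1 AT1 e1] := nonneg_at_m1_divdiff AT' xN.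
have [T2 AT2 e2] := nonneg_at_m1_divdiff AT1 xN.
exists (F + T'.[x N] *: newton x N ^+ 2 + T1.[x N] *: (newton x N * newton x N.+1)), T2.
split => //.
- by apply: (KD); [apply: (KD) => //|]; apply: (KZ);
    do ?[exact: nonneg_at_m1_ge0|exact: K1|exact: K2].
- rewrite mulnS; apply: leq_trans (size_polyD _ _) _; rewrite geq_max.
  apply/andP; split.
    apply: leq_trans (size_polyD _ _) _; rewrite geq_max; apply/andP; split.
      by apply: leq_trans sF _; lia.
    apply: leq_trans (size_scale_leq _ _) _; apply: leq_trans (size_polyMleq _ _) _.
    by rewrite !size_newton; lia.
  apply: leq_trans (size_scale_leq _ _) _; apply: leq_trans (size_polyMleq _ _) _.
  by rewrite !size_newton; lia.
- rewrite {1}eT {1}e1 {1}e2 newtonS -!mul_polyC; ring.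
Qed.

End Hermite.

(** * Energy bounds for polynomial potentials *)

Definition append_node (R : Type) k (u : 'I_k -> R) (top : R) (l : nat) : R :=
  oapp u top (insub l).

Lemma append_node_ord (R : Type) k (u : 'I_k -> R) top (i : 'I_k) :
  append_node u top i = u i.
Proof. by rewrite /append_node valK. Qed.

Lemma append_node_top (R : Type) k (u : 'I_k -> R) top : append_node u top k = top.
Proof. by rewrite /append_node insubN // ltnn. Qed.

Lemma append_node_ind (R : Type) k (u : 'I_k -> R) top (P : R -> Prop) l :
  (forall i, P (u i)) -> P top -> P (append_node u top l).
Proof. by move=> Pu Pt; rewrite /append_node; case: insubP => [i _ _|_] /=. Qed.

Lemma append_node_lt (R : numDomainType) k (u : 'I_k -> R) top i j :
  (forall i j : 'I_k, (i < j)%N -> u i < u j) -> (forall i, u i < top) ->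
  (i < j <= k)%N -> append_node u top i < append_node u top j.
Proof.
move=> u_lt u_top /andP[ij jk]; have ik := leq_trans ij jk.
rewrite -[i]/(nat_of_ord (Ordinal ik)) append_node_ord.
move: jk; rewrite leq_eqVlt => /predU1P[->|jk]; first by rewrite append_node_top.
by rewrite -[j]/(nat_of_ord (Ordinal jk)) append_node_ord u_lt.
Qed.

Lemma mean_zeroth_coef (R : realType) n q (f : {poly R}) : (0 < q)%N ->
  binomial_mean n q n%:R f = (q ^ n)%:R * zeroth_coef n q f.
Proof.
by move=> q0; rewrite /zeroth_coef mulVKf // pnatr_eq0 expn_eq0 negb_and -lt0n q0.
Qed.

Lemma horner_mulXD1 (R : comNzRingType) (f : {poly R}) t :
  (('X + 1) * f).[t] = (t + 1) * f.[t].
Proof. by rewrite hornerM hornerD hornerX -polyC1 hornerC. Qed.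

Section PolynomialPotential.
Variables (R : realType) (q k M : nat) (h : R -> R) (T : {poly R}).
Hypotheses (q_gt0 : (0 < q)%N) (k_gt0 : (0 < k)%N) (M_gt0 : (0 < M)%N).
Hypothesis T_cone : nonneg_at_m1 T.
Hypothesis T_le : forall t, -1 <= t < 1 -> T.[t] <= h t.

Lemma energy_ge_odd n (alpha rho : 'I_k -> R) (C : {set hamming_space n q}) :
  (0 < n)%N -> #|C| = M -> levenshtein_odd n q M alpha rho ->
  M%:R * \sum_(i < k) rho i * T.[alpha i] <= energy h C.
Proof.
move=> n_gt0 CM [alpha_itv alpha_lt rho_gt0 quad].
have k2 : (2 * k - 1).+1 = (2 * k)%N by lia.
have Q0 : 0 < (q ^ n)%:R :> R by rewrite ltr0n expn_gt0 q_gt0.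
have M0 : 0 < M%:R :> R by rewrite ltr0n.
(* The point [1] joins the nodes as the largest one, with weight [1 / M]; the factor [q ^ n] turns
   [f_0] into [binomial_mean]. *)
pose x := append_node alpha 1.
pose w l := (q ^ n)%:R * append_node rho M%:R^-1 l.
have pd i : (i <= k)%N -> posdef n q n%:R (newton x i).
  apply: (@posdef_newton R n q n%:R q_gt0 _ k x w) => //.
  - by rewrite ltr0n.
  - move=> a b; apply: append_node_lt => // c; by have /andP[] := alpha_itv c.
  - move=> l _; rewrite mulr_gt0 // /append_node; case: insubP => [j _ _|_] //=.
    by rewrite invr_gt0.
  - move=> f sf; rewrite mean_zeroth_coef // quad ?k2 // big_ord_recr /=.
    rewrite /x /w !append_node_top mulrDr [LHS]addrC mulr_sumr; congr (_ + _).
      by apply: eq_bigr => j _; rewrite !append_node_ord mulrA.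
    by rewrite [f.[1] / _]mulrC mulrA.
(* [newton x k] involves the [alpha i] alone, so the point [1] is not interpolated. *)
have [||||F [T' [pF sF AT' eT]]] :=
  @hermite_decomposition R _ x k T (posdef_cone n q n%:R).
- move=> i _; rewrite /x.
  apply: (append_node_ind (P := fun t => -1 <= t)) => [j|]; last by lra.
  by have /andP[/ltW] := alpha_itv j.
- by move=> i ik; rewrite expr2; apply: posdefM; apply: pd; exact: ltnW.
- by move=> i ik; apply: posdefM; apply: pd => //; exact: ltnW.
- exact: T_cone.
have FT t : -1 <= t < 1 -> F.[t] <= h t.
  move=> t1; apply: le_trans (T_le t1); rewrite eT hornerD lerDl hornerM.
  rewrite horner_exp mulr_ge0 ?sqr_ge0 //.
  by apply: nonneg_at_m1_ge0 => //; case/andP: t1.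
have := energy_ge n_gt0 q_gt0 (C := C) _ pF FT; rewrite CM => /(_ M_gt0).
(* The quadrature turns the bound for [F] into [M] times the weighted sum of its values at the
   [alpha i], where [F] and [T] agree. *)
apply: le_trans; rewrite quad ?k2 // mulrDl divfK ?gt_eqF // addrAC subrr add0r mulrC.
rewrite le_eqVlt; apply/orP; left; apply/eqP; congr (_ * _).
apply: eq_bigr => i _; rewrite eT hornerD hornerM horner_exp.
by rewrite -(append_node_ord alpha 1 i) newton_root // expr0n mul0r addr0.
Qed.

(** Here [t + 1 = 2 (n + 1 - z) / (n + 1)] and [(n + 1 - z) 'C(n + 1, z) = (n + 1) 'C(n, z)]; the
    term [z = n + 1] vanishes. *)
Lemma binomial_mean_mulXD1 n (g : {poly R}) :
  binomial_mean n.+1 q n.+1%:R (('X + 1) * g) = 2 * binomial_mean n q n.+1%:R g.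
Proof.
rewrite /binomial_mean big_ord_recr /= mulr_sumr.
have n0 : n.+1%:R != 0 :> R by rewrite pnatr_eq0.
rewrite [X in _ + X = _](_ : _ = 0) ?addr0.
  apply: eq_bigr => z _; rewrite !hornerE !natrM.
  have zn : (z <= n.+1)%N by apply: ltnW.
  have /(congr1 (fun m => m%:R : R)) := mul_bin_down n.+1 z.
  rewrite !natrM natrB //= => e.
  have -> : 'C(n, z)%:R = (n.+1%:R - z%:R) * 'C(n.+1, z)%:R / n.+1%:R :> R.
    by rewrite -e mulrC mulKf.
  by move: (g.[_]) => gz; field.
by rewrite !hornerE /=; move: (g.[_]) => gz; field.
Qed.

(** The factor [t + 1] is [2 / (n + 1)] times the number of agreeing coordinates. *)
Lemma posdef_mulXD1 n (f : {poly R}) :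
  posdef n q n.+1%:R f -> posdef n.+1 q n.+1%:R (('X + 1) * f).
Proof.
move=> /posdef_lift Kf.
have c0 : 0 <= 2 / n.+1%:R :> R by rewrite divr_ge0.
apply: gram_ext (gramM (gram_cst _ c0) Kf) => x y; rewrite hornerM.
have n0 : n.+1%:R != 0 :> R by rewrite pnatr_eq0.
rewrite mulrA; congr (_ * _).
by rewrite natrB ?hamming_dist_le // !hornerE; field.
Qed.

Lemma energy_ge_even n (beta gamma : 'I_k.+1 -> R) (C : {set hamming_space n q}) :
  (0 < n)%N -> #|C| = M -> levenshtein_even n q M beta gamma ->
  M%:R * \sum_(i < k.+1) gamma i * T.[beta i] <= energy h C.
Proof.
case: n C => // n C _ CM [beta0 beta_lt1 beta_lt gamma_gt0 quad].
have Q0 : 0 < (q ^ n.+1)%:R :> R by rewrite ltr0n expn_gt0 q_gt0.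
have M0 : 0 < M%:R :> R by rewrite ltr0n.
have beta_gt (i : 'I_k) : -1 < beta (lift ord0 i) by rewrite -beta0; apply: beta_lt.
(* The quadrature for [(t + 1) f] loses the node [-1] and multiplies the weights by [1 + beta i],
   and by [2] at the point [1]. The division by [2] undoes [binomial_mean_mulXD1]. *)
pose x := append_node (beta \o lift ord0) 1.
pose w l := (q ^ n.+1)%:R / 2 *
  append_node (fun i : 'I_k => gamma (lift ord0 i) * (1 + beta (lift ord0 i)))
    (2 / M%:R) l.
have pd i : (i <= k)%N -> posdef n q n.+1%:R (newton x i).
  apply: (@posdef_newton R n q n.+1%:R q_gt0 _ k x w) => //.
  - move=> a b; apply: append_node_lt => [c d cd|c]; last exact: beta_lt1.
    by apply: beta_lt; rewrite !lift0.
  - move=> l _; rewrite mulr_gt0 ?divr_gt0 // /append_node.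
    case: insubP => [j _ _|_] /=; last by rewrite divr_gt0.
    by rewrite mulr_gt0 //; have := beta_gt j; lra.
  - move=> f sf; have two0 : (2 : R) != 0 by rewrite pnatr_eq0.
    apply: (mulfI two0).
    rewrite -binomial_mean_mulXD1 mean_zeroth_coef // quad; last first.
      apply: leq_trans (size_polyMleq _ _) _.
      by rewrite -polyC1 size_XaddC; exact: sf.
    rewrite [in RHS]big_ord_recr [in LHS]big_ord_recl beta0 /= /x /w !append_node_top.
    rewrite !horner_mulXD1 addNr mul0r mulr0 add0r mulrDr [LHS]addrC mulrDr; congr (_ + _).
      rewrite !mulr_sumr; apply: eq_bigr => j _; rewrite !append_node_ord /=.
      rewrite horner_mulXD1; move: (f.[_]) => fj.
      by field.
    by field; rewrite gt_eqF.
(* The node [-1] is interpolated simply and the others doubly: split off [T(-1)], then interpolate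
   the quotient [F0] in the cone [K] of polynomials that become positive definite when multiplied by
   [t + 1]. *)
have [F0 AF0 eT0] := nonneg_at_m1_divdiff T_cone (lexx (-1)).
pose K (f : {poly R}) := posdef n.+1 q n.+1%:R (('X + 1) * f).
have [K0 KD KZ] := posdef_cone n.+1 q (n.+1%:R : R).
have cK : poly_cone K.
  split=> [|f g Kf Kg|a f a0 Kf]; rewrite /K ?mulr0 //.
    by rewrite mulrDr; exact: KD.
  by rewrite -scalerAr; exact: KZ.
have [||||F [T' [KF sF AT' eT]]] := @hermite_decomposition R K x k F0 cK.
- move=> i _; rewrite /x.
  apply: (append_node_ind (P := fun t => -1 <= t)) => [j|]; last by lra.
  exact/ltW/beta_gt.
- by move=> i ik; apply/posdef_mulXD1; rewrite expr2; apply: posdefM; apply: pd; exact: ltnW.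
- by move=> i ik; apply/posdef_mulXD1; apply: posdefM; apply: pd => //; exact: ltnW.
- exact: AF0.
pose G := T.[-1]%:P + ('X + 1) * F.
have eTG : T = G + ('X + 1) * (newton x k ^+ 2 * T').
  by rewrite /G [LHS]eT0 eT polyCN; ring.
have pG : posdef n.+1 q n.+1%:R G.
  apply: KD => //.
  have T1 : 0 <= T.[-1] by apply: nonneg_at_m1_ge0.
  by apply: gram_ext (gram_cst _ T1) => a b; rewrite hornerC.
have sG : (size G <= (2 * k).+1)%N.
  apply: leq_trans (size_polyD _ _) _; rewrite geq_max; apply/andP; split.
    by apply: leq_trans (size_polyC_leq1 _) _.
  apply: leq_trans (size_polyMleq _ _) _.
  by rewrite -polyC1 size_XaddC; exact: sF.
have GT t : -1 <= t < 1 -> G.[t] <= h t.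
  move=> t1; apply: le_trans (T_le t1); rewrite eTG hornerD lerDl horner_mulXD1.
  rewrite mulr_ge0 //; first by lra.
  rewrite hornerM horner_exp mulr_ge0 ?sqr_ge0 //.
  by apply: nonneg_at_m1_ge0 => //; case/andP: t1.
have := energy_ge (ltn0Sn n) q_gt0 (C := C) _ pG GT; rewrite CM => /(_ M_gt0).
apply: le_trans; rewrite quad // mulrDl divfK ?gt_eqF // addrAC subrr add0r mulrC.
rewrite le_eqVlt; apply/orP; left; apply/eqP; congr (_ * _).
apply: eq_bigr => i _; congr (_ * _); rewrite eTG hornerD horner_mulXD1.
case: (unliftP ord0 i) => [j|] ->; last by rewrite beta0 addNr mul0r addr0.
rewrite hornerM horner_exp -[beta _]/((beta \o lift ord0) j) -(append_node_ord _ 1 j).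
by rewrite newton_root // expr0n /= mul0r mulr0 addr0.
Qed.

End PolynomialPotential.

(** * Bernstein approximation of absolutely monotone functions *)

Section Bernstein.
Variable R : realType.
Local Notation D := (`[-1, 1[%classic : set R).

(** What the mean value theorem asks for on [[s, t]], with [s = -1] allowed. *)
Definition has_derivative (f df : R -> R) : Prop :=
  (forall t : R, -1 <= t < 1 -> f s @[s --> within D (nbhs t)] --> f t) /\
  (forall t : R, -1 < t < 1 -> is_derive t 1 f (df t)).

Lemma derivable_in_slope f (t e : R) : derivable_in D f t -> 0 < e ->
  exists2 d, 0 < d & forall s : R, -1 <= s < 1 -> s != t -> `|t - s| < d ->
    `|derive_in D f t - slope_at f t s| < e.
Proof.
move=> /cvgrPdist_lt/(_ e) + e0 => /(_ e0) /nbhs_ballP[d /= d0 H].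
by exists d => // s s1 st ts; apply: H => //=; rewrite in_itv.
Qed.

Lemma derivable_in_has_derivative f :
  (forall t : R, -1 <= t < 1 -> derivable_in D f t) ->
  has_derivative f (derive_in D f).
Proof.
move=> fD; split=> t t1.
  apply/cvgrPdist_lt => e e0.
  have [d d0 H] := derivable_in_slope (fD t t1) ltr01.
  set l := derive_in D f t in H.
  have l0 : 0 < `|l| + 1 by rewrite ltr_wpDl.
  apply/nbhs_ballP; exists (Num.min d (e / (`|l| + 1))) => /=.
    by rewrite lt_min d0 divr_gt0.
  move=> s; rewrite /ball /= lt_min => /andP[sd se].
  rewrite in_itv /= => s1; have [->|st] := eqVneq s t; first by rewrite subrr normr0.
  have st0 : s - t != 0 by rewrite subr_eq0.
  have := H s s1 st sd.
  have -> : f t - f s = (t - s) * slope_at f t s by rewrite /slope_at; field.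
  rewrite normrM => Hs.
  have : `|slope_at f t s| <= `|l| + 1.
    rewrite -[X in `|X|](subKr l) (le_trans (ler_normB _ _)) // lerD2l; exact: ltW.
  move=> Hl; apply: le_lt_trans (ler_wpM2l (normr_ge0 _) Hl) _.
  by rewrite -ltr_pdivlMr.
have t1' : -1 <= t < 1 by case/andP: t1 => /ltW -> ->.
set l := derive_in D f t.
have cvl : (fun u : R => u^-1 *: ((f \o shift t) (u *: (1 : R)) - f t)) @ 0^' --> l.
  apply/cvgrPdist_lt => e e0.
  have [d d0 H] := derivable_in_slope (fD t t1') e0.
  (* Increments shorter than the distances to [-1] and [1] stay in the domain, so the relative limit
     is the two-sided one. *)
  apply/nbhs_ballP; exists (Num.min d (Num.min (1 - t) (t + 1))) => /=.
    by rewrite !lt_min d0 /=; apply/andP; split; lra.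
  move=> u; rewrite /ball /= !lt_min sub0r normrN => /and3P[ud ua ub] u0.
  have := H (u + t); rewrite -/l /slope_at addrK [u *: 1]mulr1 => {}H.
  have -> : u^-1 *: (f (u + t) - f t) = (f (u + t) - f t) / u by rewrite mulrC.
  apply: H.
  - by move: ua ub; rewrite !ltr_norml => /andP[? ?] /andP[? ?]; apply/andP; split; lra.
  - by rewrite -subr_eq0 addrK.
  - by rewrite opprD addrCA subrr addr0 normrN.
apply: DeriveDef; first by apply/cvg_ex; exists l.
exact: cvg_lim cvl.
Qed.

Lemma has_derivative_horner (p : {poly R}) :
  has_derivative (horner p) (horner p^`()).
Proof.
split=> t _; last exact: is_derive_poly.
by apply: cvg_within_filter; exact: continuous_horner.
Qed.

Lemma has_derivativeB f df g dg : has_derivative f df -> has_derivative g dg ->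
  has_derivative (fun t => f t - g t) (fun t => df t - dg t).
Proof.
move=> [cf ff] [cg gg]; split=> t t1; first exact: cvgB (cf t t1) (cg t t1).
have := ff t t1; have := gg t t1 => *; exact: is_deriveB.
Qed.

Lemma has_derivativeM f df g dg : has_derivative f df -> has_derivative g dg ->
  has_derivative (fun t => f t * g t) (fun t => f t * dg t + g t * df t).
Proof.
move=> [cf ff] [cg gg]; split=> t t1; first exact: cvgM (cf t t1) (cg t t1).
have := ff t t1; have := gg t t1 => *; exact: is_deriveM.
Qed.

Lemma has_derivative_ext f df dg : (forall t : R, -1 < t < 1 -> df t = dg t) ->
  has_derivative f df -> has_derivative f dg.
Proof. by move=> e [cf ff]; split=> // t t1; rewrite -e //; exact: ff. Qed.

Lemma has_derivative_le f df s t : has_derivative f df ->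
  (forall u : R, -1 < u < 1 -> 0 <= df u) -> -1 <= s -> s <= t -> t < 1 -> f s <= f t.
Proof.
move=> [cf ff] df0 s1; rewrite le_eqVlt => /predU1P[->//|st] t1.
have itv u : u \in `]s, t[ -> -1 < u < 1.
  by rewrite in_itv /= => /andP[? ?]; apply/andP; split; lra.
have [||c cst e] := @MVT R f df s t st.
- by move=> u /itv; exact: ff.
- apply: (@continuous_subspaceW _ _ `[s, t] D).
    by move=> u /=; rewrite !in_itv /= => /andP[? ?]; apply/andP; split; lra.
  by apply/subspace_continuousP => u; rewrite /= in_itv /= => /cf.
- by rewrite -subr_ge0 e mulr_ge0 ?df0 ?itv // subr_ge0 ltW.
Qed.

Variable h : R -> R.
Hypothesis h_am : absolutely_monotone D h.
Local Notation H j := (derive_in_n D j h).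

Lemma am_ge0 j t : -1 <= t < 1 -> 0 <= H j t.
Proof. by move=> t1; have [|_] := h_am j (t := t); rewrite //= in_itv. Qed.

Lemma am_has_derivative j : has_derivative (H j) (H j.+1).
Proof.
apply: derivable_in_has_derivative => t t1.
by have [|] := h_am j (t := t); rewrite //= in_itv.
Qed.

(** The Taylor polynomial at [-1], of degree below [m], of the [j]-th derivative; differentiation
    raises [j] and lowers [m]. *)
Definition taylor_m1 j m : {poly R} :=
  \sum_(i < m) (H (j + i) (-1) / i`!%:R) *: ('X + 1) ^+ i.

Lemma deriv_taylor_m1 j m : (taylor_m1 j m.+1)^`() = taylor_m1 j.+1 m.
Proof.
rewrite /taylor_m1 big_ord_recl derivD derivZ expr0 derivC scaler0 add0r.
rewrite linear_sum; apply: eq_bigr => i _; rewrite lift0 /= derivZ deriv_exp /=.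
rewrite derivD derivX -polyC1 derivC addr0 mul1r addnS -scalerMnr scalerMnl.
congr (_ *: _); rewrite -[LHS]mulr_natr factS natrM /=; field.
by rewrite nat1r !pnatr_eq0 -lt0n fact_gt0.
Qed.

Lemma taylor_m1_at j m : (taylor_m1 j m.+1).[-1] = H j (-1).
Proof.
rewrite /taylor_m1 big_ord_recl hornerD horner_sum big1 => [|i _].
  by rewrite expr0 addr0 !hornerE fact0 divr1.
by rewrite hornerZ horner_exp !hornerE addNr expr0n mulr0.
Qed.

Lemma taylor_m1_nonneg j m : nonneg_at_m1 (taylor_m1 j m).
Proof.
suff gen (c : nat -> R) : (forall i, 0 <= c i) ->
    nonneg_at_m1 (\sum_(i < m) c i *: ('X + 1) ^+ i).
  apply: (gen (fun i => H (j + i) (-1) / i`!%:R)) => i.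
  by rewrite divr_ge0 ?am_ge0 //; apply/andP; split; lra.
elim: m c => [|m IH] c c0; first by rewrite big_ord0; exact: nonneg_at_m1_0.
rewrite big_ord_recl expr0 alg_polyC.
have -> : \sum_(i < m) c (lift ord0 i) *: ('X + 1) ^+ lift ord0 i =
    ('X + 1) * \sum_(i < m) c i.+1 *: ('X + 1) ^+ i.
  by rewrite mulr_sumr; apply: eq_bigr => i _; rewrite lift0 exprS scalerAr.
by apply: nonneg_at_m1_S => //; apply: (IH (fun i => c i.+1)).
Qed.

Let rem j m t := H j t - (taylor_m1 j m).[t].

Lemma rem_has_derivative j m : has_derivative (rem j m.+1) (rem j.+1 m).
Proof.
rewrite /rem -deriv_taylor_m1.
exact: has_derivativeB (am_has_derivative j) (has_derivative_horner _).
Qed.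

Lemma rem0E j t : rem j 0 t = H j t.
Proof. by rewrite /rem /taylor_m1 big_ord0 horner0 subr0. Qed.

Lemma rem_m1 j m : rem j m.+1 (-1) = 0.
Proof. by rewrite /rem taylor_m1_at subrr. Qed.

(** Induction on [m]: the remainder vanishes at [-1], and its derivative is the remainder of one
    order less for the next derivative of [h]. *)
Lemma rem_ge0 j m t : -1 <= t < 1 -> 0 <= rem j m t.
Proof.
elim: m j t => [|m IH] j t t1; first by rewrite rem0E am_ge0.
rewrite -(rem_m1 j m); case/andP: t1 => t0 t1.
apply: has_derivative_le (rem_has_derivative j m) _ _ _ _ => // u /andP[u0 u1].
by apply: IH; rewrite ltW.
Qed.

(* [(1 + t) R' - (m + 1) R >= 0] for the Taylor remainder [R] of order [m + 1]
   makes [R / (1 + t) ^ (m + 1)] nondecreasing. *)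
Lemma rem_log_derivative j m t : -1 <= t < 1 ->
  0 <= (1 + t) * rem j.+1 m t - m.+1%:R * rem j m.+1 t.
Proof.
have lin : has_derivative (fun t : R => 1 + t) (fun=> 1).
  have -> : (fun t : R => 1 + t) = horner (1%:P + 'X).
    by apply/funext => u; rewrite hornerD hornerC hornerX.
  apply: has_derivative_ext (has_derivative_horner _) => u _.
  by rewrite derivD derivX derivC add0r hornerE.
have cst (a : R) : has_derivative (fun=> a) (fun=> 0).
  have -> : (fun _ : R => a) = horner a%:P by apply/funext => u; rewrite hornerC.
  apply: has_derivative_ext (has_derivative_horner _) => u _.
  by rewrite derivC horner0.
(* [phi j (m + 1)] has derivative [phi (j + 1) m], [phi j 0] has derivative [(1 + t) H (j + 2)], and
   all vanish at [-1]. *)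
pose phi j m t := (1 + t) * rem j.+1 m t - m.+1%:R * rem j m.+1 t.
have phi_m1 i l : phi i l (-1) = 0 by rewrite /phi rem_m1 subrr mul0r mulr0 subr0.
rewrite -/(phi j m t); elim: m j t => [|m IH] j t /andP[t0 t1].
  rewrite -(phi_m1 j 0%N).
  have dphi : has_derivative (phi j 0%N) (fun t => (1 + t) * H j.+2 t).
    have R1 : has_derivative (rem j.+1 0) (H j.+2).
      have -> : rem j.+1 0 = H j.+1 by apply/funext => u; exact: rem0E.
      exact: am_has_derivative.
    apply: has_derivative_ext (has_derivativeB (has_derivativeM lin R1)
      (has_derivativeM (cst 1) (rem_has_derivative j 0))) => u u1 /=.
    by ring.
  apply: (has_derivative_le dphi) => // u /andP[u0 u1].
  by rewrite mulr_ge0 ?am_ge0 // ?u1 ?ltW //; lra.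
rewrite -(phi_m1 j m.+1).
have dphi : has_derivative (phi j m.+1) (phi j.+1 m).
  apply: has_derivative_ext (has_derivativeB
    (has_derivativeM lin (rem_has_derivative j.+1 m))
    (has_derivativeM (cst m.+2%:R) (rem_has_derivative j m.+1))) => u u1 /=.
  by rewrite /phi -[m.+2%:R]natr1; ring.
by apply: (has_derivative_le dphi) => // u /andP[u0 u1]; apply: IH; rewrite u1 ltW.
Qed.

Lemma rem_ratio_le m (s t : R) : -1 < s -> s <= t -> t < 1 ->
  rem 0 m.+1 s / (1 + s) ^+ m.+1 <= rem 0 m.+1 t / (1 + t) ^+ m.+1.
Proof.
move=> s1 st t1.
pose p : {poly R} := ('X + 1) ^+ m.+1.
have pE u : p.[u] = (1 + u) ^+ m.+1 by rewrite /p horner_exp !hornerE addrC.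
have dpE u : p^`().[u] = m.+1%:R * (1 + u) ^+ m.
  rewrite /p deriv_exp derivD derivX -polyC1 derivC addr0 mul1r hornerMn horner_exp.
  by rewrite !hornerE addrC mulr_natl.
have [_ dR] := rem_has_derivative 0 m.
have dG (u : R) : -1 < u < 1 -> is_derive u (1 : R) (fun u => rem 0 m.+1 u * (p.[u])^-1)
    (((1 + u) * rem 1 m u - m.+1%:R * rem 0 m.+1 u) / (1 + u) ^+ m.+2).
  move=> u1; have u0 : 1 + u != 0 by apply: lt0r_neq0; lra.
  have pu : p.[u] != 0 by rewrite pE expf_neq0.
  have dr := dR u u1; have dp := is_derive_poly p u.
  apply: is_derive_eq (is_deriveM dr (is_deriveV pu dp)) _.
  rewrite /GRing.scale /= pE dpE !exprS; field.
  by rewrite expf_neq0.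
rewrite -!pE; move: st; rewrite le_eqVlt => /predU1P[->//|st].
have itv (u : R) : s <= u <= t -> -1 < u < 1.
  by move=> /andP[? ?]; apply/andP; split; lra.
have itvo (u : R) : u \in `]s, t[ -> -1 < u < 1.
  by rewrite in_itv /= => /andP[/ltW ? /ltW ?]; apply: itv; apply/andP.
have [|c cst e] := @MVT R (fun u => rem 0 m.+1 u * (p.[u])^-1) _ s t st
  (fun u ui => dG u (itvo u ui)).
- apply: derivable_within_continuous => u; rewrite in_itv /= => /itv u1.
  by have [] := dG u u1.
- rewrite -subr_ge0 e mulr_ge0 //; last by rewrite subr_ge0 ltW.
  have /andP[c0 c1] := itvo c cst.
  apply: divr_ge0; last by apply: exprn_ge0; lra.
  by apply: rem_log_derivative; rewrite c1 ltW.
Qed.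

Lemma taylor_m1_le m t : -1 <= t < 1 -> (taylor_m1 0 m).[t] <= h t.
Proof. by move=> /(rem_ge0 0 m); rewrite subr_ge0. Qed.

Lemma taylor_m1_cvg (t : R) :
  -1 <= t < 1 -> (taylor_m1 0 m.+1).[t] @[m --> \oo] --> h t.
Proof.
move=> /andP[]; rewrite le_eqVlt => /predU1P[<- _|t0 t1].
  under eq_fun do rewrite taylor_m1_at.
  exact: cvg_cst.
(* With [r] midway between [t] and [1], [rem_ratio_le] bounds the remainder at [t] by [z ^ (m + 1)]
   times the one at [r], which is at most [h r]; and [z < 1]. *)
pose r := (1 + t) / 2.
have rt : t <= r by rewrite /r; lra.
have r1 : r < 1 by rewrite /r; lra.
pose z := (1 + t) / (1 + r).
have z0 : 0 <= z by rewrite divr_ge0 //; lra.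
have z1 : z < 1 by rewrite ltr_pdivrMr /r; lra.
have tD : -1 <= t < 1 by rewrite t1 ltW.
have rD : -1 <= r < 1 by rewrite r1 andbT; lra.
apply: (@squeeze_cvgr _ _ _ _ (fun m => h t - z * z ^+ m * h r) (fun=> h t)).
- near=> m; rewrite taylor_m1_le // andbT lerBlDr -lerBlDl -exprS.
  apply: le_trans (_ : z ^+ m.+1 * rem 0 m.+1 r <= _); last first.
    rewrite ler_wpM2l ?exprn_ge0 // /rem /= lerBlDr lerDl.
    by apply: nonneg_at_m1_ge0; [exact: taylor_m1_nonneg|lra].
  have := rem_ratio_le m t0 rt r1.
  have p0 : 0 < (1 + t) ^+ m.+1 by apply: exprn_gt0; lra.
  rewrite ler_pdivrMr // => /le_trans; apply.
  by rewrite /z expr_div_n [leLHS]mulrC [leRHS]mulrAC mulrA.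
- rewrite -[X in _ --> X]subr0 -(mul0r (h r)) -(mulr0 z).
  apply: cvgB; first exact: cvg_cst.
  apply: cvgM; last exact: cvg_cst.
  apply: cvgM; first exact: cvg_cst.
  by apply: cvg_expr; rewrite ger0_norm.
- exact: cvg_cst.
Unshelve. all: by end_near.
Qed.

End Bernstein.

(** * From polynomial to absolutely monotone potentials *)

(** The Taylor polynomials at [-1] are admissible [T], and the bound passes to their limit [h] at
    the nodes. *)
Lemma weighted_sum_le_limit (R : realType) (h : R -> R) m (w x : 'I_m -> R) (a b : R) :
  absolutely_monotone `[-1, 1[ h -> (forall i, -1 <= x i < 1) ->
  (forall T, nonneg_at_m1 T -> (forall t, -1 <= t < 1 -> T.[t] <= h t) ->
     a * \sum_i w i * T.[x i] <= b) ->
  a * \sum_i w i * h (x i) <= b.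
Proof.
move=> h_am x_itv bound.
have cv : a * \sum_i w i * (taylor_m1 h 0 j.+1).[x i] @[j --> \oo] -->
          a * \sum_i w i * h (x i).
  apply: cvgM; first exact: cvg_cst.
  apply: cvg_big => [|i _]; first exact: add_continuous.
  apply: cvgM; [exact: cvg_cst|exact: taylor_m1_cvg].
apply: (cvgr_to_le cv); near=> j; apply: bound; first exact: taylor_m1_nonneg.
by move=> t; exact: taylor_m1_le.
Unshelve. all: by end_near.
Qed.

Lemma le_min_energy (R : realType) n q M (h : R -> R) b :
  (forall C : {set hamming_space n q}, #|C| = M -> b <= energy h C) ->
  (b%:E <= min_energy n q M h)%E.
Proof.
(* [leey] handles the neutral element [+oo] of the minimum. *)
move=> bC; apply: le_bigmin; first exact: leey.
by move=> C /eqP /bC; rewrite lee_fin.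
Qed.

(** The optimality claim: the quadrature turns the left side into [M] times the weighted sum of the
    [f (x i)], compared with [h] node by node. *)
Lemma quadrature_le (R : realType) n q M tau m (x w : 'I_m -> R) (h : R -> R)
    (f : {poly R}) :
  (0 < M)%N -> quadrature n q M tau x w -> (size f <= tau.+1)%N ->
  (forall i, 0 <= w i) -> (forall i, f.[x i] <= h (x i)) ->
  zeroth_coef n q f * M%:R - f.[1] <= M%:R * \sum_i w i * h (x i).
Proof.
move=> M_gt0 quad sf w0 fh; have M0 : M%:R != 0 :> R by rewrite pnatr_eq0 -lt0n.
rewrite quad // mulrDl divfK // addrAC subrr add0r mulrC ler_wpM2l //.
by apply: ler_sum => i _; rewrite ler_wpM2l.
Qed.

Theorem theorem4p2 (R : realType) (n q k M : nat) (h : R -> R)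
    (n_gt0 : (0 < n)%N) (q_ge2 : (2 <= q)%N) (k_gt0 : (0 < k)%N)
    (h_gt0 : forall t : R, -1 <= t < 1 -> 0 < h t)
    (h_am : absolutely_monotone `[-1, 1[ h) :
  (forall alpha rho : 'I_k -> R,
      (rao n q (2 * k - 1) < M <= rao n q (2 * k))%N ->
      levenshtein_odd n q M alpha rho ->
      ((M%:R * \sum_(i < k) rho i * h (alpha i))%:E <= min_energy n q M h)%E /\
      (forall f : {poly R}, (size f <= (2 * k - 1).+1)%N ->
         (forall t : R, -1 <= t < 1 -> f.[t] <= h t) ->
         zeroth_coef n q f * M%:R - f.[1]
           <= M%:R * \sum_(i < k) rho i * h (alpha i)))
  /\
  (forall beta gamma : 'I_k.+1 -> R,
      (rao n q (2 * k) < M <= rao n q (2 * k + 1))%N ->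
      levenshtein_even n q M beta gamma ->
      ((M%:R * \sum_(i < k.+1) gamma i * h (beta i))%:E <= min_energy n q M h)%E /\
      (forall f : {poly R}, (size f <= (2 * k).+1)%N ->
         (forall t : R, -1 <= t < 1 -> f.[t] <= h t) ->
         zeroth_coef n q f * M%:R - f.[1]
           <= M%:R * \sum_(i < k.+1) gamma i * h (beta i))).
Proof.
have q_gt0 := ltnW q_ge2.
(* The strict lower bound on [M] gives [M > 0], so division by [M] is legitimate. *)
split=> [alpha rho|beta gamma] /andP[/(leq_ltn_trans (leq0n _)) M_gt0 _] lev.
  have [alpha_itv _ rho_gt0 quad] := lev.
  have itv i : -1 <= alpha i < 1 by case/andP: (alpha_itv i) => /ltW -> ->.
  split=> [|f sf fh]; last first.
    by apply: quadrature_le quad sf _ _ => // i; [exact: ltW|exact: fh].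
  apply: le_min_energy => C CM; apply: weighted_sum_le_limit => // T AT Th.
  exact: energy_ge_odd lev.
have [beta0 beta_lt1 beta_lt gamma_gt0 quad] := lev.
have itv i : -1 <= beta i < 1.
  rewrite beta_lt1 andbT -beta0; case: (unliftP ord0 i) => [j|] -> //.
  by apply/ltW/beta_lt.
split=> [|f sf fh]; last first.
  by apply: quadrature_le quad sf _ _ => // i; [exact: ltW|exact: fh].
apply: le_min_energy => C CM; apply: weighted_sum_le_limit => // T AT Th.
exact: energy_ge_even lev.
Qed.
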